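(* Let $n\ge2$ be an integer. The evaluation $\langle\!\langle\cdot\rangle\!\rangle$ of the unoriented planar circle without vertices is $$\langle\!\langle \bigcirc\rangle\!\rangle=[2n-1]+1 .$$
   Context: Throughout, $n\ge 2$ is an integer, $q$ is a formal variable, and $[m]=\frac{q^m-q^{-m}}{q-q^{-1}}$ for $m\in\mathbb Z$. Graphs. A planar $4$-valent graph is embedded in $\mathbb R^2$, considered up to planar isotopy; it may have loops, multiple edges, several components, and components that are circles without vertices. An orientation of all edges (and circles) is balanced if every vertex has two incoming and two outgoing edge-ends. A vertex is then crossing-type if in cyclic order the ends are in, in, out, out, and alternating if they are in, out, in, out. Local relations relate graphs that are identical outside a disk. MOY graph polynomial. For oriented planar $4$-valent graphs $\Gamma$ all of whose vertices are crossing-type, $R(\Gamma)\in\mathbb Z[q,q^{-1}]$ is the (well-defined, unique) planar-isotopy-invariant function with $R(\emptyset)=1$ and satisfying the following local relations. (i) A circle without vertices bounding an empty disk may be removed with factor $[n]$. (ii) A vertex having a loop edge that bounds an empty disk may be replaced by an arc with factor $[n-1]$. (iii) An empty bigon face whose two edges are both directed from one vertex to the other equals $[2]$ times the graph with the bigon collapsed to a single vertex. (iv) An empty bigon face with vertices $v,w$ and edges $v\to w$, $w\to v$ equals $G_1+[n-2]G_2$, where in $G_2$ the bigon is replaced by two arcs, one joining the two outer ends at $v$ and one joining the two outer ends at $w$, and in $G_1$ by the other two disjoint orientation-compatible arcs (each joining an outer end at $v$ to an outer end at $w$). (v) For three parallel, equally oriented strands, let $E_i$ ($i=1,2$) denote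 a vertex merging strands $i,i+1$; then $E_1E_2E_1+E_2=E_2E_1E_2+E_1$ (composition by stacking). (vi) Let the disk have six boundary points $p_1,\dots,p_6$ in cyclic order, alternately incoming and outgoing. Let $T$ be the triangle graph with directed-cycle triangular face whose three vertices carry outer ends $\{p_1,p_2\},\{p_3,p_4\},\{p_5,p_6\}$, and $T'$ the analogous one with $\{p_2,p_3\},\{p_4,p_5\},\{p_6,p_1\}$. Let $M$ be three disjoint arcs joining $p_1p_2,p_3p_4,p_5p_6$ and $M'$ three disjoint arcs joining $p_2p_3,p_4p_5,p_6p_1$. Then $T+[n-3]M'=T'+[n-3]M$. Bracket. For such $\Gamma$, $[\Gamma]=(q^{1-n})^{\mathrm{rot}(\Gamma)}R(\Gamma)$, where $\mathrm{rot}(\Gamma)$ is the sum over the disjoint oriented circles obtained by splicing each vertex according to orientation (into two non-crossing arcs, each from an incoming to an adjacent outgoing end) of $+1$ for each counterclockwise and $-1$ for each clockwise circle. For a balanced oriented graph with alternating vertices, $[\,\cdot\,]$ is extended by expanding each alternating vertex as $q$ times the smoothing in which each incoming strand turns left, plus $q^{-1}$ times the smoothing in which each incoming strand turns right. Evaluation of unoriented graphs. For an unoriented planar $4$-valent graph $\Gamma$, $\langle\!\langle\Gamma\rangle\!\rangle=\sum_{o}[\Gamma^{o}]$, the sum over all balanced orientations $o$ of $\Gamma$ (so a circle without vertices has two orientations). *)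

(* Defs.v *)
From HB Require Import structures.
From mathcomp Require Import all_boot all_order all_algebra fraction finmap.
From mathcomp Require Import all_classical all_reals all_analysis.
From Stdlib Require Import Relations.Relation_Operators.

Set Implicit Arguments.
Unset Strict Implicit.
Unset Printing Implicit Defensive.

Import Order.TTheory GRing.Theory Num.Theory.
Import numFieldNormedType.Exports.

Local Open Scope classical_set_scope.
Local Open Scope ring_scope.

(** * Coefficients *)

(* Z[q, q^-1] is used through its embedding in its field of fractions. *)
Definition coef := {fraction {poly int}}.

Definition q : coef := tofrac 'X.

Definition qint (m : int) : coef := (q ^ m - q ^ (- m)) / (q - q^-1).

Definition laurent (x : coef) : Prop :=
  exists (p : {poly int}) (k : nat), x = tofrac p / q ^+ k.

(** * Plane graphs

  A plane graph is drawn with straight arcs, and given by the finite set of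
  its arcs.  The end points of the arcs are its nodes.  Nodes with four
  arc-ends are the vertices of the graph; nodes with two arc-ends are mere
  bends, so that an edge is a maximal chain of arcs through bends, and a
  circle without vertices is a closed polygon all of whose nodes are bends.
  An oriented graph is the set of its darts, i.e. of its directed arcs (tail,
  head); an unoriented graph contains both (a, b) and (b, a) for each of its
  arcs. *)

Notation pt R := (R * R)%type.
Notation dart R := (pt R * pt R)%type.

Definition rev_dart (R : realType) (s : dart R) : dart R := (s.2, s.1).

Definition segment (R : realType) (s : dart R) : set (pt R) :=
  [set p | exists2 t : R, 0 <= t <= 1 &
     p = ((1 - t) * s.1.1 + t * s.2.1, (1 - t) * s.1.2 + t * s.2.2)].

Definition ends (R : realType) (s : dart R) : set (pt R) := [set s.1; s.2].

Definition indeg (R : realType) (G : {fset dart R}) (p : pt R) : nat :=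
  #|` [fset s in G | s.2 == p]%fset|.

Definition outdeg (R : realType) (G : {fset dart R}) (p : pt R) : nat :=
  #|` [fset s in G | s.1 == p]%fset|.

Definition embedded (R : realType) (G : {fset dart R}) : Prop :=
  forall s t, s \in G -> t \in G -> t != s -> t != rev_dart s ->
    segment s `&` segment t `<=` ends s `&` ends t.

(* Planar 4-valent graphs (unoriented). *)
Definition plane_graph (R : realType) (G : {fset dart R}) : Prop :=
  [/\ embedded G,
      forall s, s \in G -> rev_dart s \in G /\ s.1 != s.2 &
      forall p, outdeg G p \in [:: 0; 2; 4]%N].

(* Planar 4-valent graphs with a balanced orientation; the condition at a bend
   says that the edge through it is oriented coherently. *)
Definition balanced_graph (R : realType) (G : {fset dart R}) : Prop :=
  [/\ embedded G,
      forall s, s \in G -> rev_dart s \notin G &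
      forall p, indeg G p = outdeg G p /\ (outdeg G p <= 2)%N].

Definition balanced_orientations (R : realType) (G : {fset dart R})
    : {fset {fset dart R}} :=
  [fset o in fpowerset G |
     `[< (forall s, s \in G -> (s \in o) (+) (rev_dart s \in o)) /\
         balanced_graph o >]]%fset.

(** * Cyclic order at a vertex *)

(* The cross product of a - p and b - p. *)
Definition cross (R : realType) (p a b : pt R) : R :=
  (a.1 - p.1) * (b.2 - p.2) - (a.2 - p.2) * (b.1 - p.1).

(* For pairwise distinct rays pa, pb, pc: they occur in this counterclockwise
   cyclic order iff at least two of the three successive angles, which sum to
   a full turn, are smaller than a half turn. *)
Definition ccw3 (R : realType) (p a b c : pt R) : Prop :=
  [\/ 0 < cross p a b /\ 0 < cross p b c,
      0 < cross p b c /\ 0 < cross p c a |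
      0 < cross p c a /\ 0 < cross p a b].

Definition ccw4 (R : realType) (p a b c d : pt R) : Prop :=
  ccw3 p a b c /\ ccw3 p a c d.

Definition crossing_type (R : realType) (G : {fset dart R}) (p : pt R) : Prop :=
  exists i1 i2 o1 o2 : pt R,
    [/\ (i1, p) \in G, (i2, p) \in G, (p, o1) \in G, (p, o2) \in G &
        ccw4 p i1 i2 o1 o2].

(* Oriented graphs all of whose vertices are crossing-type. *)
Definition crossing_graph (R : realType) (G : {fset dart R}) : Prop :=
  balanced_graph G /\ forall p, outdeg G p = 2%N -> crossing_type G p.

(** * Planar isotopy *)

(* The time of an isotopy ranges over the whole real line, which is harmless:
   an isotopy over [0, 1] extends by constancy. *)
Definition ambient_isotopy (R : realType) (H : R * pt R -> pt R) : Prop :=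
  [/\ continuous H,
      forall p, H (0, p) = p &
      exists2 K : R * pt R -> pt R, continuous K &
        forall t p, K (t, H (t, p)) = p /\ H (t, K (t, p)) = p].

Definition moved (R : realType) (G G' : {fset dart R}) : Prop :=
  exists2 H : R * pt R -> pt R, ambient_isotopy H &
    G' = [fset (H (1, s.1), H (1, s.2)) | s in G]%fset /\
    forall s, s \in G ->
      [set H (1, p) | p in segment s] = segment (H (1, s.1), H (1, s.2)).

Definition inner (R : realType) (s : dart R) (c : pt R) : Prop :=
  segment s c /\ ~ ends s c.

(* A bend is inserted at c on the arc s. *)
Definition bend (R : realType) (s : dart R) (c : pt R) (G : {fset dart R})
    : {fset dart R} :=
  ((G `\ s) `|` [fset (s.1, c); (c, s.2)])%fset.

(* A planar isotopy between two drawings becomes an ambient isotopy that maps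
   straight arcs onto straight arcs once enough bends have been inserted in
   both. *)
Definition redrawn (R : realType) (G G' : {fset dart R}) : Prop :=
  moved G G' \/
  exists s c, [/\ s \in G, inner s c & G' = bend s c G].

Definition redrawn_unoriented (R : realType) (G G' : {fset dart R}) : Prop :=
  [/\ plane_graph G, plane_graph G' &
      moved G G' \/
      exists s c, [/\ s \in G, inner s c &
                      G' = bend (rev_dart s) c (bend s c G)]].

Definition isotopic (R : realType) : {fset dart R} -> {fset dart R} -> Prop :=
  clos_refl_sym_trans _ (@redrawn_unoriented R).

(* Isotopy invariance on the class C of oriented graphs. *)
Definition isotopy_invariant (R : realType) (C : {fset dart R} -> Prop)
    (W : {fset dart R} -> coef) : Prop :=
  forall G G', C G -> C G' -> redrawn G G' -> W G = W G'.

(** * Local relations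

  All local relations are drawn in the square below; by isotopy invariance
  this makes them available in every disk. *)

Definition disk (R : realType) : set (pt R) :=
  [set p | -3 < p.1 < 3 /\ -3 < p.2 < 3].
Arguments disk : clear implicits.

Definition outside (R : realType) (X : {fset dart R}) : Prop :=
  forall s, s \in X -> segment s `&` disk R = set0.

(* The linear relation lhs = rhs between pictures in the disk: whichever way
   the pictures are completed by a common outside part X into graphs of the
   class C. *)
Definition respects (R : realType) (C : {fset dart R} -> Prop)
    (W : {fset dart R} -> coef) (lhs rhs : seq (coef * {fset dart R})) : Prop :=
  forall X, outside X ->
    (forall t, t \in lhs ++ rhs -> C (X `|` t.2)%fset) ->
    \sum_(t <- lhs) t.1 * W (X `|` t.2)%fset =
    \sum_(t <- rhs) t.1 * W (X `|` t.2)%fset.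

Definition flip (R : realType) (G : {fset dart R}) : {fset dart R} :=
  [fset rev_dart s | s in G]%fset.

(* A relation drawn with one orientation is also imposed on the picture with
   all arcs reversed: circles and loops may be clockwise or counterclockwise. *)
Definition moy_relation (R : realType) (W : {fset dart R} -> coef)
    (lhs rhs : seq (coef * {fset dart R})) : Prop :=
  respects (@crossing_graph R) W lhs rhs /\
  respects (@crossing_graph R) W
    [seq (t.1, flip t.2) | t <- lhs] [seq (t.1, flip t.2) | t <- rhs].

(** * Pictures *)

(* The arcs of a family of oriented polygonal lines. *)
Definition draw (R : realType) (ls : seq (seq (pt R))) : {fset dart R} :=
  [fset s in flatten [seq zip l (behead l) | l <- ls]]%fset.

Section Pictures.
Variable R : realType.
Implicit Types x y : R.

Definition pic_circle : {fset dart R} :=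
  draw [:: [:: (1, 0); (0, 1); (-1, 0); (0, -1); (1, 0)] ].

Definition pic_loop : {fset dart R} :=
  draw [:: [:: (-3, 0); (0, 0); (1, 1); (-1, 1); (0, 0); (3, 0)] ].
Definition pic_line : {fset dart R} := draw [:: [:: (-3, 0); (3, 0)] ].

(* Upward strands, and an upward vertex merging two neighbouring strands. *)
Definition strand x y : {fset dart R} :=
  draw [:: [:: (x, y - 1); (x, y + 1)] ].
Definition merge x y : {fset dart R} :=
  draw [:: [:: (x - 1, y - 1); (x, y); (x - 1, y + 1)];
           [:: (x + 1, y - 1); (x, y); (x + 1, y + 1)] ].

Definition two_strands y := (strand (-1) y `|` strand 1 y)%fset.
Definition pic_parallel_bigon : {fset dart R} :=
  (merge 0 (-2) `|` merge 0 0 `|` two_strands 2)%fset.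
Definition pic_parallel_vertex : {fset dart R} :=
  (two_strands (-2) `|` merge 0 0 `|` two_strands 2)%fset.

Definition pic_cyclic_bigon : {fset dart R} :=
  draw [:: [:: (-3, -2); (-1, 0); (-3, 2)]; [:: (3, 2); (1, 0); (3, -2)];
           [:: (-1, 0); (0, 1); (1, 0); (0, -1); (-1, 0)] ].
Definition pic_G1 : {fset dart R} :=
  draw [:: [:: (-3, -2); (3, -2)]; [:: (3, 2); (-3, 2)] ].
Definition pic_G2 : {fset dart R} :=
  draw [:: [:: (-3, -2); (-2, 0); (-3, 2)]; [:: (3, 2); (2, 0); (3, -2)] ].

Definition row_id y : {fset dart R} :=
  (strand (-2) y `|` strand 0 y `|` strand 2 y)%fset.
Definition row_E1 y : {fset dart R} := (merge (-1) y `|` strand 2 y)%fset.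
Definition row_E2 y : {fset dart R} := (strand (-2) y `|` merge 1 y)%fset.
Definition stack (r1 r2 r3 : R -> {fset dart R}) : {fset dart R} :=
  (r1 (-2) `|` r2 0 `|` r3 2)%fset.

(* The six boundary points, incoming for p1, p3, p5. *)
Let p1 : pt R := (3, 0).
Let p2 : pt R := (3, 3).
Let p3 : pt R := (0, 3).
Let p4 : pt R := (-3, 0).
Let p5 : pt R := (-3, -3).
Let p6 : pt R := (0, -3).

Definition pic_M : {fset dart R} :=
  draw [:: [:: p1; (2, 1); p2]; [:: p3; (-1, 1); p4]; [:: p5; (-1, -2); p6] ].
Definition pic_M' : {fset dart R} :=
  draw [:: [:: p3; (1, 2); p2]; [:: p5; (-2, -1); p4]; [:: p1; (1, -1); p6] ].
Definition pic_T : {fset dart R} :=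
  (pic_M `|` draw [:: [:: (2, 1); (-1, 1); (-1, -2); (2, 1)] ])%fset.
Definition pic_T' : {fset dart R} :=
  (pic_M' `|` draw [:: [:: (1, 2); (1, -1); (-2, -1); (1, 2)] ])%fset.

Definition pic_alternating : {fset dart R} :=
  draw [:: [:: (-3, 0); (0, 0); (0, 3)]; [:: (3, 0); (0, 0); (0, -3)] ].
Definition pic_left : {fset dart R} :=
  draw [:: [:: (-3, 0); (0, 3)]; [:: (3, 0); (0, -3)] ].
Definition pic_right : {fset dart R} :=
  draw [:: [:: (-3, 0); (0, -3)]; [:: (3, 0); (0, 3)] ].

End Pictures.

(** * The graph polynomial, the bracket and the evaluation *)

Record is_graph_polynomial (R : realType) (n : nat)
    (W : {fset dart R} -> coef) : Prop := {
  gp_laurent : forall G, crossing_graph G -> laurent (W G);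
  gp_isotopy : isotopy_invariant (@crossing_graph R) W;
  gp_empty : W fset0 = 1;
  gp_circle :
    moy_relation W [:: (1, pic_circle R)] [:: (qint n%:Z, fset0)];
  gp_loop :
    moy_relation W [:: (1, pic_loop R)] [:: (qint (n%:Z - 1), pic_line R)];
  gp_parallel_bigon :
    moy_relation W [:: (1, pic_parallel_bigon R)]
                   [:: (qint 2, pic_parallel_vertex R)];
  gp_cyclic_bigon :
    moy_relation W [:: (1, pic_cyclic_bigon R)]
                   [:: (1, pic_G1 R); (qint (n%:Z - 2), pic_G2 R)];
  gp_braid :
    moy_relation W
      [:: (1, stack (@row_E1 R) (@row_E2 R) (@row_E1 R));
          (1, stack (@row_id R) (@row_E2 R) (@row_id R))]
      [:: (1, stack (@row_E2 R) (@row_E1 R) (@row_E2 R));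
          (1, stack (@row_id R) (@row_E1 R) (@row_id R))];
  gp_triangle :
    moy_relation W
      [:: (1, pic_T R); (qint (n%:Z - 3), pic_M' R)]
      [:: (1, pic_T' R); (qint (n%:Z - 3), pic_M R)] }.

(* The arc t follows the arc s after all vertices have been spliced: at a
   vertex, s is connected to the outgoing end adjacent to it in the cyclic
   order in, in, out, out. *)
Definition follows (R : realType) (G : {fset dart R}) (s t : G) : bool :=
  let p := (val s).2 in
  `[< (val t).1 = p /\
      (outdeg G p = 1%N \/
       exists i o, [/\ (i, p) \in G, (p, o) \in G &
         ccw4 p (val s).1 i o (val t).2 \/ ccw4 p i (val s).1 (val t).2 o]) >].

Definition spliced_circles (R : realType) (G : {fset dart R}) : {set {set G}} :=
  [set [set t | connect (@follows R G) s t] | s : G]%SET.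

(* Twice the signed area (shoelace formula): positive for counterclockwise
   circles, negative for clockwise ones. *)
Definition area2 (R : realType) (G : {fset dart R}) (c : {set G}) : R :=
  \sum_(s in c) cross (0, 0) (val s).1 (val s).2.

Definition rot (R : realType) (G : {fset dart R}) : int :=
  \sum_(c in spliced_circles G) sgz (area2 c).

Record is_bracket (R : realType) (n : nat) (W br : {fset dart R} -> coef)
    : Prop := {
  br_crossing : forall G, crossing_graph G ->
    br G = (q ^ (1 - n%:Z)) ^ rot G * W G;
  br_isotopy : isotopy_invariant (@balanced_graph R) br;
  br_alternating :
    respects (@balanced_graph R) br
      [:: (1, pic_alternating R)]
      [:: (q, pic_left R); (q^-1, pic_right R)] }.

Definition evaluation (R : realType) (br : {fset dart R} -> coef)
    (G : {fset dart R}) : coef :=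
  \sum_(o <- balanced_orientations G) br o.

Definition unoriented_circle (R : realType) : {fset dart R} :=
  (pic_circle R `|` flip (pic_circle R))%fset.

(* Main.v *)
Require Import Defs.
From mathcomp Require Import all_boot all_order all_algebra fraction finmap.
From mathcomp Require Import all_classical all_reals all_analysis.
From mathcomp Require Import zify ring lra.

(** The circle has two balanced orientations, the counterclockwise polygon and
  its reverse.  Neither has a vertex, so the circle relation gives [n] for the
  graph polynomial of both, and their rotation numbers 1 and -1 turn the two
  brackets into q^(1-n) [n] and q^(n-1) [n].  The sum is [2n-1] + 1: of
  the terms of the two numerators, q^(2n-1) - q^(1-2n) makes up [2n-1], and the
  remaining q - q^-1 cancels the common denominator.

  This computes the evaluation of one drawing, the square with corners
  (1, 0), (0, 1), (-1, 0), (0, -1).  Any other drawing is reached from it by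
  elementary moves, so it remains to see that each move preserves the
  evaluation.  The bracket of a balanced graph is invariant under the oriented
  version of a move, and therefore it is enough that the move induces a
  bijection between balanced orientations ([evaluation_bij]).
  - An ambient isotopy acts on arcs by an injective map, and so does its
    inverse; degrees and the choice of one dart per arc are carried along
    ([evaluation_moved]).
  - An inserted bend c lies on no other arc because the drawing is embedded.
    The four new darts are the only ones at c, and balance at c forces the two
    halves of the divided arc to be oriented coherently, so that an orientation
    of the divided arc is the same as an orientation of the arc
    ([evaluation_bend]). *)

Set Implicit Arguments.
Unset Strict Implicit.
Unset Printing Implicit Defensive.

Import Order.TTheory GRing.Theory Num.Theory.

Local Open Scope ring_scope.

(** * Darts and degrees *)

Lemma rev_dartK (R : realType) : involutive (@rev_dart R).
Proof. by case. Qed.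

Lemma rev_dart_inj (R : realType) : injective (@rev_dart R).
Proof. exact: can_inj (@rev_dartK R). Qed.

Lemma rev_dart_eq (R : realType) (s t : dart R) :
  (rev_dart s == t) = (s == rev_dart t).
Proof. exact: (can2_eq (@rev_dartK R) (@rev_dartK R)). Qed.

Lemma mem_flip (R : realType) (G : {fset dart R}) (s : dart R) :
  (s \in flip G) = (rev_dart s \in G).
Proof.
apply/imfsetP/idP => /= [[t tG ->]|sG]; first by rewrite rev_dartK.
by exists (rev_dart s); rewrite ?rev_dartK.
Qed.

Lemma segment_rev (R : realType) (s : dart R) :
  segment (rev_dart s) = segment s.
Proof.
apply/seteqP; split=> p [x /andP[x0 x1] ->];
  (exists (1 - x); [lra|congr pair => /=; lra]).
Qed.

Lemma ends_rev (R : realType) (s : dart R) : ends (rev_dart s) = ends s.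
Proof. by rewrite /ends setUC. Qed.

Lemma ends_segment (R : realType) (s : dart R) (c : pt R) :
  ends s c -> segment s c.
Proof.
case: s => -[a1 a2] [b1 b2]; rewrite /ends /segment /= => -[->|->] /=.
  by exists 0; [lra|congr pair; lra].
by exists 1; [lra|congr pair; lra].
Qed.

Lemma embedded_sub (R : realType) (G o : {fset dart R}) :
  embedded G -> {subset o <= G} -> embedded o.
Proof. by move=> eG oG s t so to; apply: eG; apply: oG. Qed.

Lemma embedded_flip_union (R : realType) (G : {fset dart R}) :
  embedded G -> embedded (G `|` flip G)%fset.
Proof.
move=> eG s t; rewrite !in_fsetU !mem_flip => sG tG nts ntrs.
have [rts rtrs] : rev_dart t != s /\ rev_dart t != rev_dart s.
  by rewrite rev_dart_eq (inj_eq (@rev_dart_inj R)).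
case/orP: sG => sG; case/orP: tG => tG.
- exact: eG.
- by rewrite -(segment_rev t) -(ends_rev t); apply: eG.
- by rewrite -(segment_rev s) -(ends_rev s); apply: eG; rewrite ?rev_dartK.
- rewrite -(segment_rev s) -(ends_rev s) -(segment_rev t) -(ends_rev t).
  by apply: eG; rewrite // rev_dartK.
Qed.

Lemma count_sum (T : choiceType) (G : {fset T}) (P : pred T) :
  #|` [fset t in G | P t]%fset| = (\sum_(t <- G) P t)%N.
Proof.
rewrite card_fset_sum1 -big_fset_condE big_mkcond /=.
by apply: eq_bigr => t _; case: (P t).
Qed.

Lemma outdeg_gt0P (R : realType) (G : {fset dart R}) (p : pt R) :
  reflect (exists x, (p, x) \in G) (0 < outdeg G p)%N.
Proof.
rewrite /outdeg cardfs_gt0; apply: (iffP (fset0Pn _)) => [[[y x]]|[x px]].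
  by rewrite in_fset inE /= => /andP[yx /eqP <-]; exists x.
by exists (p, x); rewrite in_fset inE /= px /= eqxx.
Qed.

Lemma indeg_gt0P (R : realType) (G : {fset dart R}) (p : pt R) :
  reflect (exists x, (x, p) \in G) (0 < indeg G p)%N.
Proof.
rewrite /indeg cardfs_gt0; apply: (iffP (fset0Pn _)) => [[[x y]]|[x xp]].
  by rewrite in_fset inE /= => /andP[xy /eqP <-]; exists x.
by exists (x, p); rewrite in_fset inE /= xp /= eqxx.
Qed.

(** A disjoint union of oriented circles has no vertex whose type could fail to
  be a crossing. *)
Lemma crossing_of_degree1 (R : realType) (G : {fset dart R}) :
  balanced_graph G -> (forall p, (outdeg G p <= 1)%N) -> crossing_graph G.
Proof. by move=> bG deg1; split=> // p dp; move: (deg1 p); rewrite dp. Qed.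

(** * Balanced orientations *)

(** Embeddedness passes to subsets, and choosing exactly one of the two darts of
  each arc already excludes opposite darts; this leaves the degrees. *)
Lemma balanced_orientationsP (R : realType) (G o : {fset dart R}) :
  embedded G ->
  reflect
    [/\ {subset o <= G},
        forall s, s \in G -> (s \in o) (+) (rev_dart s \in o) &
        forall p, indeg o p = outdeg o p /\ (outdeg o p <= 2)%N]
    (o \in balanced_orientations G).
Proof.
move=> eG; rewrite !inE /= fpowersetE; apply: (iffP andP).
  by case=> /fsubsetP oG /asboolP[xo [_ _ dego]].
case=> oG xo dego; split; first exact/fsubsetP.
apply/asboolP; split=> //; split=> //; first exact: embedded_sub oG.
by move=> s so; move: (xo _ (oG _ so)); rewrite so.
Qed.

Lemma balanced_orientation_graph (R : realType) (G o : {fset dart R}) :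
  o \in balanced_orientations G -> balanced_graph o.
Proof. by rewrite !inE /= => /andP[_ /asboolP[]]. Qed.

Lemma evaluation_bij (R : realType) (br : {fset dart R} -> coef)
    (G G' : {fset dart R}) (f : {fset dart R} -> {fset dart R}) :
  {in balanced_orientations G, forall o, f o \in balanced_orientations G'} ->
  {in balanced_orientations G &, injective f} ->
  {in balanced_orientations G', forall u,
     exists2 o, o \in balanced_orientations G & u = f o} ->
  {in balanced_orientations G, forall o, br o = br (f o)} ->
  evaluation br G = evaluation br G'.
Proof.
move=> fG fI fS brf; rewrite /evaluation.
rewrite [RHS](perm_big [seq f o | o <- balanced_orientations G]) /=.
  by rewrite big_map; apply: eq_big_seq.
apply: uniq_perm; [exact: fset_uniq|by rewrite map_inj_in_uniq ?fset_uniq|].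
move=> u; apply/idP/mapP => [/fS[v vG ->]|[v vG ->]]; last exact: fG.
by exists v.
Qed.

(** * Invariance under ambient isotopy *)

Definition image_graph (R : realType) (h : pt R -> pt R) (G : {fset dart R}) :
    {fset dart R} :=
  [fset (h s.1, h s.2) | s in G]%fset.

Lemma dart_map_inj (R : realType) (h : pt R -> pt R) : injective h ->
  injective (fun s : dart R => (h s.1, h s.2)).
Proof. by move=> hI [a b] [c d] /= [/hI-> /hI->]. Qed.

Lemma mem_image_graph (R : realType) (h : pt R -> pt R) (G : {fset dart R})
    a b :
  injective h -> ((h a, h b) \in image_graph h G) = ((a, b) \in G).
Proof. by move=> hI; rewrite (mem_imfset _ _ (dart_map_inj hI) (a, b)). Qed.

Lemma image_graphK (R : realType) (h k : pt R -> pt R) (G : {fset dart R}) :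
  cancel h k -> image_graph k (image_graph h G) = G.
Proof.
move=> hK; apply/fsetP=> -[a b]; apply/imfsetP/idP => /=.
  by case=> s /imfsetP[[c d] /= cdG -> [-> ->]]; rewrite /= !hK.
move=> abG; exists (h a, h b); last by rewrite /= !hK.
by apply/imfsetP; exists (a, b).
Qed.

Lemma count_image (R : realType) (h : pt R -> pt R) (G : {fset dart R})
    (P : pred (dart R)) :
  injective h ->
  #|` [fset t in image_graph h G | P t]%fset| =
  #|` [fset s in G | P (h s.1, h s.2)]%fset|.
Proof.
move=> hI; have mI := dart_map_inj hI.
transitivity #|` image_graph h [fset s in G | P (h s.1, h s.2)]%fset|;
  last by rewrite card_imfset.
congr (#|` _|); apply/fsetP=> t; rewrite !inE /=.
apply/andP/imfsetP => /= [[/imfsetP[s /= sG ->] Ps]|[s]].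
  by exists s; rewrite // !inE sG.
by rewrite !inE /= => /andP[sG Ps] ->; split=> //; apply/imfsetP; exists s.
Qed.

Lemma indeg_image (R : realType) (h : pt R -> pt R) (G : {fset dart R}) p :
  injective h -> indeg (image_graph h G) (h p) = indeg G p.
Proof.
move=> hI; rewrite /indeg count_image//; congr (#|` _|).
by apply/fsetP=> s; rewrite !inE /= (inj_eq hI).
Qed.

Lemma outdeg_image (R : realType) (h : pt R -> pt R) (G : {fset dart R}) p :
  injective h -> outdeg (image_graph h G) (h p) = outdeg G p.
Proof.
move=> hI; rewrite /outdeg count_image//; congr (#|` _|).
by apply/fsetP=> s; rewrite !inE /= (inj_eq hI).
Qed.

(** The embeddedness of the image is a hypothesis because the image of a
  segment under [h] need not be the segment between the image points. *)
Lemma image_orientation (R : realType) (h k : pt R -> pt R)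
    (G o : {fset dart R}) :
  cancel h k -> cancel k h -> embedded G -> embedded (image_graph h G) ->
  o \in balanced_orientations G ->
  image_graph h o \in balanced_orientations (image_graph h G).
Proof.
move=> hK kK eG eG' /(balanced_orientationsP _ eG)[oG xo dego].
have hI := can_inj hK.
apply/balanced_orientationsP => //; split.
- by move=> t /imfsetP[s /= /oG sG ->]; apply/imfsetP; exists s.
- move=> t /imfsetP[[a b] /= abG ->]; move: (xo _ abG).
  by rewrite /rev_dart /= !mem_image_graph.
- by move=> p; rewrite -[p]kK indeg_image// outdeg_image.
Qed.

(** The bijection is the image under the final homeomorphism of the isotopy; the
  same isotopy moves each orientation to its image. *)
Lemma evaluation_moved (R : realType) (br : {fset dart R} -> coef)
    (G G' : {fset dart R}) :
  isotopy_invariant (@balanced_graph R) br ->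
  embedded G -> embedded G' -> moved G G' ->
  evaluation br G = evaluation br G'.
Proof.
move=> brI eG eG' [H isoH [defG' straight]].
have [_ _ [K _ HK]] := isoH.
pose h p := H (1, p); pose k p := K (1, p).
have hK : cancel h k by move=> p; have [] := HK 1 p.
have kK : cancel k h by move=> p; have [] := HK 1 p.
have {}defG' : G' = image_graph h G by [].
have oG' o : o \in balanced_orientations G ->
    image_graph h o \in balanced_orientations G'.
  move=> oG; rewrite defG'.
  by apply: (image_orientation hK kK); rewrite -?defG'.
apply: (@evaluation_bij _ _ _ _ (image_graph h)) => //.
- by move=> o1 o2 _ _; apply: can_inj => o; exact: image_graphK.
- move=> u uG'; exists (image_graph k u); last by rewrite image_graphK.
  rewrite -(image_graphK G hK) -defG'.
  by apply: (image_orientation kK hK); rewrite ?defG' ?image_graphK -?defG'.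
move=> o oG; apply: brI (balanced_orientation_graph oG) _ _.
  exact: balanced_orientation_graph (oG' _ oG).
left; exists H => //; split=> // s so; apply: straight.
by case/(balanced_orientationsP _ eG): oG => /(_ _ so).
Qed.

(** * Invariance under insertion of a bend *)

Definition fresh (R : realType) (c : pt R) (G : {fset dart R}) : Prop :=
  forall t, t \in G -> t.1 != c /\ t.2 != c.

(** An arc through [c] would meet [s] in an inner point of [s], which
  embeddedness forbids. *)
Lemma inner_fresh (R : realType) (G : {fset dart R}) (s : dart R) (c : pt R) :
  embedded G -> s \in G -> inner s c -> fresh c G.
Proof.
move=> eG sG [sc nsc] t tG.
suff nt : ~ ends t c.
  by split; apply/eqP => tc; apply: nt; rewrite /ends /= -tc; [left|right].
move=> tc; have [ts|nts] := eqVneq t s; first by rewrite ts in tc.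
have [trs|ntrs] := eqVneq t (rev_dart s).
  by apply: nsc; move: tc; rewrite trs /ends /= => -[]; [right|left].
by have [] := eG s t sG tG nts ntrs c (conj sc (ends_segment tc)).
Qed.

Lemma mem_bend (R : realType) (s t : dart R) (c : pt R) (G : {fset dart R}) :
  (t \in bend s c G) =
  [|| (t != s) && (t \in G), t == (s.1, c) | t == (c, s.2)].
Proof. by rewrite !inE. Qed.

(** An identity of sums, without subtraction, covering both degrees at once: the
  dart [s] is traded for its two halves. *)
Lemma count_bend (R : realType) (s : dart R) (c : pt R) (G : {fset dart R})
    (P : pred (dart R)) :
  s \in G -> fresh c G ->
  (P s + #|` [fset t in bend s c G | P t]%fset| =
   P (s.1, c) + (P (c, s.2) + #|` [fset t in G | P t]%fset|))%N.
Proof.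
move=> sG frG; have [s1c s2c] := frG _ sG.
have -> : bend s c G = ((s.1, c) |` ((c, s.2) |` (G `\ s)))%fset.
  apply/fsetP=> t; rewrite mem_bend !inE.
  by case: (t \in G); do 3?[case: (t == _) => //=].
rewrite !count_sum !big_fsetU1 /=.
- by rewrite [in RHS](big_fsetD1 s) //=; lia.
- by rewrite !inE negb_and; apply/orP; right; apply/negP=> /frG[]; rewrite eqxx.
- rewrite !inE !xpair_eqE (negbTE s1c) /= negb_and.
  by apply/orP; right; apply/negP=> /frG[_]; rewrite eqxx.
Qed.

Lemma outdeg_bend (R : realType) (s : dart R) (c p : pt R) (G : {fset dart R}) :
  s \in G -> fresh c G ->
  outdeg (bend s c G) p = ((c == p) + outdeg G p)%N.
Proof.
move=> sG frG.
exact: addnI (count_bend (fun t => t.1 == p) sG frG).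
Qed.

Lemma indeg_bend (R : realType) (s : dart R) (c p : pt R) (G : {fset dart R}) :
  s \in G -> fresh c G ->
  indeg (bend s c G) p = ((c == p) + indeg G p)%N.
Proof.
move=> sG frG.
apply: (@addnI (s.2 == p)); rewrite addnCA.
exact: count_bend (fun t => t.2 == p) sG frG.
Qed.

Lemma deg_fresh (R : realType) (c : pt R) (G : {fset dart R}) :
  fresh c G -> indeg G c = 0%N /\ outdeg G c = 0%N.
Proof.
move=> frG; rewrite /indeg /outdeg !count_sum.
by split; rewrite big1_seq // => t /andP[_ /frG[/negbTE t1 /negbTE t2]];
  rewrite ?t1 ?t2.
Qed.

Lemma mem_bend_both (R : realType) (s t : dart R) (c : pt R)
    (G : {fset dart R}) :
  s \in G -> fresh c G ->
  (t \in bend (rev_dart s) c (bend s c G)) =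
  ([&& t \in G, t != s & t != rev_dart s]
   || [|| t == (s.1, c), t == (c, s.2), t == (s.2, c) | t == (c, s.1)]).
Proof.
case: s => a b sG frG; have /= [/negbTE ac /negbTE bc] := frG _ sG.
rewrite !mem_bend /rev_dart /=.
have [->|_] := eqVneq t (a, c).
  by rewrite !xpair_eqE (eq_sym c) ac !andbF /= ?orbT.
have [->|_] := eqVneq t (c, b).
  by rewrite !xpair_eqE (eq_sym c) bc /= ?orbT.
by case: (t \in G); do 4?[case: (t == _) => //=].
Qed.

(** The graph obtained by dividing an arc does not depend on which of its two
  darts names the arc; hence orientations containing [rev_dart s] are handled
  by the lemmas on orientations containing [s]. *)
Lemma bend_bothC (R : realType) (s : dart R) (c : pt R) (G : {fset dart R}) :
  s \in G -> rev_dart s \in G -> fresh c G ->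
  bend s c (bend (rev_dart s) c G) = bend (rev_dart s) c (bend s c G).
Proof.
move=> sG rsG frG; apply/fsetP=> t.
rewrite -[in LHS](rev_dartK s) (mem_bend_both t sG frG).
rewrite (mem_bend_both t rsG frG) rev_dartK /=.
by case: (t \in G); do 6?[case: (t == _) => //=].
Qed.

(** Replacing [s] by its two halves changes no degree except at [c], where both
  the indegree and the outdegree become 1. *)
Lemma bend_orientation (R : realType) (s : dart R) (c : pt R)
    (G o : {fset dart R}) :
  plane_graph G -> s \in G -> fresh c G ->
  embedded (bend (rev_dart s) c (bend s c G)) ->
  o \in balanced_orientations G -> s \in o ->
  bend s c o \in balanced_orientations (bend (rev_dart s) c (bend s c G)).
Proof.
move=> [eG revG _] sG frG eG' /(balanced_orientationsP _ eG)[oG xo dego] so.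
have rso : rev_dart s \notin o by move: (xo s sG); rewrite so.
have fro : fresh c o by move=> t /oG/frG.
have [s1c s2c] := frG _ sG; have [_ s12] := revG _ sG.
apply/balanced_orientationsP => //; split.
- move=> t; rewrite (mem_bend_both _ sG frG) (mem_bend s).
  case/or3P=> [/andP[ts to]|->|->].
  + rewrite oG //= ts /=; case: eqVneq => // trs.
    by rewrite -trs to in rso.
  + by rewrite orbT.
  + by rewrite !orbT.
- have nin x : (x, c) \in o = false /\ (c, x) \in o = false.
    by split; apply/negP => /fro[]; rewrite /= eqxx.
  move=> t; rewrite (mem_bend_both _ sG frG) => /orP[/and3P[tG ts trs]|].
    have rtG : rev_dart t \in G by have [] := revG _ tG.
    have [t1 t2] := frG _ tG; have := xo t tG.
    rewrite !mem_bend ts /= rev_dart_eq trs /=.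
    case: t t1 t2 {ts trs tG rtG} => a b /= /negbTE t1 /negbTE t2.
    by rewrite !xpair_eqE /= t1 t2 /= !andbF !orbF.
  move: s1c s2c s12 {rso so sG eG'}; case: s => a b /= ac bc ab.
  case/or4P => /eqP->; rewrite !mem_bend !xpair_eqE /= ?eqxx /=;
    rewrite !(nin _).1 !(nin _).2 ?andbF ?orbF ?(eq_sym c) ?(negbTE ac);
    by rewrite ?(negbTE bc) ?(eq_sym b) ?(negbTE ab) ?eqxx.
move=> p; rewrite outdeg_bend // indeg_bend //.
have [<-|_] := eqVneq c p; last exact: dego.
by have [-> ->] := deg_fresh fro.
Qed.

(** The converse of [bend_orientation]: if the first half of [s] enters [c],
  then balance makes some dart leave [c], and the only one available that is not
  opposite to the first half is the second half of [s]. *)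
Lemma unbend_orientation (R : realType) (s : dart R) (c : pt R)
    (G u : {fset dart R}) :
  plane_graph G -> s \in G -> fresh c G ->
  embedded (bend (rev_dart s) c (bend s c G)) ->
  u \in balanced_orientations (bend (rev_dart s) c (bend s c G)) ->
  (s.1, c) \in u ->
  exists2 o, o \in balanced_orientations G & s \in o /\ u = bend s c o.
Proof.
move=> [eG revG _] sG frG eG' /(balanced_orientationsP _ eG')[uG xu degu] s1u.
have [rsG s12] := revG _ sG.
have [s1c s2c] := frG _ sG.
have cs1u : (c, s.1) \notin u by have := xu _ (uG _ s1u); rewrite s1u.
have s2u : (c, s.2) \in u.
  have /outdeg_gt0P[x cx] : (0 < outdeg u c)%N.
    by rewrite -(degu c).1; apply/indeg_gt0P; exists s.1.
  have := uG _ cx; rewrite (mem_bend_both _ sG frG) => /orP[/and3P[/frG[]]|].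
    by rewrite eqxx.
  case/or4P => /eqP[]; first by move=> cs1; rewrite -cs1 eqxx in s1c.
  - by move=> <-.
  - by move=> cs2; rewrite -cs2 eqxx in s2c.
  - by move=> xs1; rewrite -xs1 cx in cs1u.
have s2cu : (s.2, c) \notin u by have := xu _ (uG _ s2u); rewrite s2u.
have old t : t \in G -> (t == s) || (t == rev_dart s) -> t \notin u.
  move=> tG ts; apply/negP => /uG; rewrite (mem_bend_both _ sG frG) => /orP[|].
    by case/and3P=> _ /negbTE t1 /negbTE t2; rewrite t1 t2 in ts.
  by case/or4P=> /eqP tE; have [] := frG _ tG; rewrite tE /= eqxx.
have su : s \notin u by apply: old; rewrite ?eqxx.
have rsu : rev_dart s \notin u by apply: old; rewrite ?eqxx ?orbT.
(* Merge the two halves back into [s]. *)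
pose o := (s |` (u `\ (s.1, c) `\ (c, s.2)))%fset.
have uE : u = bend s c o.
  apply/fsetP => t; rewrite mem_bend !inE.
  have [->|_] := eqVneq t s.
    have -> : (s == (s.1, c)) = false by apply: contraNF s2c => /eqP->.
    have -> : (s == (c, s.2)) = false by apply: contraNF s1c => /eqP->.
    by rewrite (negbTE su).
  have [->|_] := eqVneq t (s.1, c); first by rewrite s1u orbT.
  by have [->|_] := eqVneq t (c, s.2); rewrite ?s2u ?orbT ?orbF.
have oG : {subset o <= G}.
  move=> t; rewrite !inE => /orP[/eqP->//|/and3P[t1 t2 tu]].
  have := uG _ tu; rewrite (mem_bend_both _ sG frG) => /orP[/and3P[]//|].
  case/or4P => /eqP tE; move: t1 t2 tu; rewrite tE ?eqxx // => _ _ tu.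
  - by rewrite tu in s2cu.
  - by rewrite tu in cs1u.
have so : s \in o by rewrite !inE eqxx.
have fro : fresh c o by move=> t /oG/frG.
exists o; last by split.
have tou t : t \in G -> t != s -> (t \in o) = (t \in u).
  move=> /frG[t1 t2] /negbTE ts; rewrite !inE ts /=.
  case: t t1 t2 {ts} => a b /= /negbTE t1 /negbTE t2.
  by rewrite !xpair_eqE t1 t2 andbF.
have srs : rev_dart s != s.
  by apply: contraNneq s12 => /(congr1 fst) /= ->.
apply/balanced_orientationsP => //; split => //.
- move=> t tG; have [rtG _] := revG _ tG.
  have [->|ts] := eqVneq t s; first by rewrite so tou // (negbTE rsu).
  have [->|trs] := eqVneq t (rev_dart s).
    by rewrite rev_dartK so tou // (negbTE rsu).
  have rts : rev_dart t != s.
    by apply: contraNneq trs => <-; rewrite rev_dartK.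
  by rewrite !tou //; apply: xu; rewrite (mem_bend_both _ sG frG) tG ts trs.
move=> p; have := degu p; rewrite uE outdeg_bend // indeg_bend //.
by case: (c == p) => // -[/addnI eq_deg le_deg]; split=> //; exact: ltnW.
Qed.

Lemma bend_inj (R : realType) (s : dart R) (c : pt R) (o1 o2 : {fset dart R}) :
  s \in o1 -> s \in o2 -> fresh c o1 -> fresh c o2 ->
  bend s c o1 = bend s c o2 -> o1 = o2.
Proof.
have sub (o o' : {fset dart R}) : s \in o' -> fresh c o ->
    bend s c o = bend s c o' -> {subset o <= o'}.
  move=> so' fro eqb t to; have [->//|ts] := eqVneq t s.
  have : t \in bend s c o' by rewrite -eqb mem_bend ts to.
  rewrite mem_bend ts /= => /or3P[//||] /eqP tE; have [] := fro _ to;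
    by rewrite tE /= eqxx.
move=> so1 so2 fr1 fr2 eqb; apply/fsetP => t; apply/idP/idP; exact: sub.
Qed.

Lemma inner_rev (R : realType) (s : dart R) (c : pt R) :
  inner s c -> inner (rev_dart s) c.
Proof. by rewrite /inner segment_rev ends_rev. Qed.

(** Each orientation is divided along the dart of the arc that it contains. *)
Lemma evaluation_bend (R : realType) (br : {fset dart R} -> coef)
    (G : {fset dart R}) (s : dart R) (c : pt R) :
  isotopy_invariant (@balanced_graph R) br ->
  plane_graph G -> embedded (bend (rev_dart s) c (bend s c G)) ->
  s \in G -> inner s c ->
  evaluation br G = evaluation br (bend (rev_dart s) c (bend s c G)).
Proof.
move=> brI pG eG' sG sc; have [eG revG _] := pG.
have frG : fresh c G by exact: inner_fresh sc.
have [rsG s12] := revG _ sG.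
have GC := bend_bothC sG rsG frG.
have frO o : o \in balanced_orientations G -> fresh c o.
  by case/(balanced_orientationsP _ eG) => oG _ _ t /oG/frG.
have rsO o : o \in balanced_orientations G -> s \notin o -> rev_dart s \in o.
  case/(balanced_orientationsP _ eG) => _ xo _ /negbTE so.
  by move: (xo s sG); rewrite so.
have eG2 : embedded (bend (rev_dart (rev_dart s)) c (bend (rev_dart s) c G)).
  by rewrite rev_dartK GC.
pose f o := if s \in o then bend s c o else bend (rev_dart s) c o.
have fG : {in balanced_orientations G, forall o,
    f o \in balanced_orientations (bend (rev_dart s) c (bend s c G))}.
  move=> o oG; rewrite /f; case: ifPn => so; first exact: bend_orientation.
  rewrite -GC -[X in bend X _ (bend _ _ _)]rev_dartK.
  exact: bend_orientation pG rsG frG eG2 oG (rsO _ oG so).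
apply: (@evaluation_bij _ _ _ _ f) => //.
- move=> o1 o2 o1G o2G.
  (* The first half of [s] remembers whether [s] was chosen, so that both
     orientations were divided along the same dart. *)
  have memf o : o \in balanced_orientations G -> ((s.1, c) \in f o) = (s \in o).
    move=> oG; rewrite /f; case: ifPn => so; rewrite mem_bend /= ?eqxx ?orbT //.
    have /negbTE-> : (s.1, c) \notin o.
      by apply/negP => /(frO _ oG)[_]; rewrite eqxx.
    have [/negbTE s1c _] := frG _ sG.
    by rewrite !xpair_eqE (negbTE s12) s1c andbF.
  move=> eqf; have := memf _ o1G; rewrite eqf memf // => so12.
  move: eqf; rewrite /f -so12; case: ifPn => so.
    by apply: bend_inj; rewrite -?so12 //; exact: frO.
  by apply: bend_inj; [apply: rsO|apply: rsO|exact: frO|exact: frO];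
    rewrite -?so12.
(* Surjectivity: some dart enters [c], from one of the two ends of the arc. *)
- move=> u uG'; have [uG xu degu] := balanced_orientationsP _ eG' uG'.
  have [s1u|s2u] : (s.1, c) \in u \/ (s.2, c) \in u.
    have : (s.1, c) \in u \/ (c, s.1) \in u.
      have := xu (s.1, c); rewrite (mem_bend_both _ sG frG) eqxx orbT.
      move=> /(_ isT).
      by rewrite /rev_dart /=; case: (_ \in u); [left|right].
    case=> [|cu]; first by left.
    have /indeg_gt0P[x xc] : (0 < indeg u c)%N.
      by rewrite (degu c).1; apply/outdeg_gt0P; exists s.1.
    have := uG _ xc; rewrite (mem_bend_both _ sG frG) => /orP[/and3P[/frG[]]|].
      by rewrite eqxx.
    have [/eqP s1c /eqP s2c] := frG _ sG.
    case/or4P => /eqP[]; first by move=> <-; left.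
    - by move=> _ /esym.
    - by move=> <-; right.
    - by move=> _ /esym.
  + have [v vG [sv ->]] := unbend_orientation pG sG frG eG' uG' s1u.
    by exists v => //; rewrite /f sv.
  + rewrite -GC -[X in bend X _ (bend _ _ _)]rev_dartK in uG'.
    have [v vG [sv ->]] := unbend_orientation pG rsG frG eG2 uG' s2u.
    exists v => //; rewrite /f ifN //.
    case/(balanced_orientationsP _ eG): vG => _ xv _; move: (xv s sG).
    by rewrite sv addbT.
move=> o oG; have oG' := fG o oG.
apply: brI (balanced_orientation_graph oG) (balanced_orientation_graph oG') _.
right; rewrite /f; case: ifPn => so; first by exists s, c.
by exists (rev_dart s), c; split=> //; [exact: rsO|exact: inner_rev].
Qed.

(** * Planar isotopy *)

Lemma evaluation_isotopic (R : realType) (br : {fset dart R} -> coef)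
    (G G' : {fset dart R}) :
  isotopy_invariant (@balanced_graph R) br -> isotopic G G' ->
  evaluation br G = evaluation br G'.
Proof.
move=> brI; elim=> {G G'} [G G' [pG pG' redrawing]|//|//|G1 G2 G3 _ -> _ ->//].
have [eG _ _] := pG; have [eG' _ _] := pG'.
case: redrawing => [mG|[s [c [sG sc GE]]]]; first exact: evaluation_moved.
by rewrite GE; apply: evaluation_bend => //; rewrite -GE.
Qed.

(** * Quadrilaterals *)

Definition quad (R : realType) (a b c d : pt R) : {fset dart R} :=
  [fset (a, b); (b, c); (c, d); (d, a)]%fset.

Lemma mem_quad (R : realType) (a b c d : pt R) (s : dart R) :
  (s \in quad a b c d) = (s \in [:: (a, b); (b, c); (c, d); (d, a)]).
Proof. by rewrite !inE -!orbA. Qed.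

(** The reversed cycle a, d, c, b is written from b on, so that reversal becomes
  the swap of a with b and of c with d. *)
Lemma flip_quad (R : realType) (a b c d : pt R) :
  flip (quad a b c d) = quad b a d c.
Proof.
apply/fsetP => -[x y]; rewrite mem_flip !mem_quad !inE /rev_dart /= !xpair_eqE.
rewrite ![(y == _) && _]andbC.
by do 4?[case: (_ && _) => //=].
Qed.

Lemma big_quad (R : realType) (T : Type) (idx : T) (op : Monoid.com_law idx)
    (a b c d : pt R) (F : dart R -> T) :
  uniq [:: a; b; c; d] ->
  \big[op/idx]_(s <- quad a b c d) F s =
  op (F (a, b)) (op (F (b, c)) (op (F (c, d)) (F (d, a)))).
Proof.
move=> abcd.
rewrite (perm_big [:: (a, b); (b, c); (c, d); (d, a)]) /=.
  by rewrite !big_cons big_nil Monoid.mulm1.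
apply: uniq_perm; [exact: fset_uniq| |exact: mem_quad].
move: abcd; rewrite /= !inE !xpair_eqE !negb_or.
case/and4P => /and3P[/negbTE-> /negbTE-> /negbTE->].
by case/andP=> /negbTE-> /negbTE-> /negbTE->.
Qed.

Lemma outdeg_quad (R : realType) (a b c d p : pt R) :
  uniq [:: a; b; c; d] ->
  outdeg (quad a b c d) p = ((a == p) + ((b == p) + ((c == p) + (d == p))))%N.
Proof. by move=> abcd; rewrite /outdeg count_sum big_quad. Qed.

Lemma indeg_quad (R : realType) (a b c d p : pt R) :
  uniq [:: a; b; c; d] ->
  indeg (quad a b c d) p = ((b == p) + ((c == p) + ((d == p) + (a == p))))%N.
Proof. by move=> abcd; rewrite /indeg count_sum big_quad. Qed.

Lemma outdeg_quad_le1 (R : realType) (a b c d p : pt R) :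
  uniq [:: a; b; c; d] -> (outdeg (quad a b c d) p <= 1)%N.
Proof.
move=> abcd; rewrite outdeg_quad //; move: abcd; rewrite /= !inE !negb_or.
case/and4P => /and3P[ab ac ad] /andP[bc bd] cd _.
have [<-|_] := eqVneq a p.
  by rewrite !(eq_sym _ a) !(negbTE ab, negbTE ac, negbTE ad).
have [<-|_] := eqVneq b p.
  by rewrite !(eq_sym _ b) !(negbTE bc, negbTE bd).
have [<-|_] := eqVneq c p; first by rewrite eq_sym (negbTE cd).
by case: (d == p).
Qed.

(** At every node exactly one dart leaves, so the four darts follow one another
  and form a single spliced circle, the whole polygon. *)
Lemma rot_quad (R : realType) (a b c d : pt R) :
  uniq [:: a; b; c; d] ->
  Defs.rot (quad a b c d) =
  sgz (cross (0, 0) a b + (cross (0, 0) b c +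
      (cross (0, 0) c d + cross (0, 0) d a))).
Proof.
move=> abcd; set G := quad a b c d.
have next (x y z : pt R) (xy : (x, y) \in G) (yz : (y, z) \in G) :
    connect (@follows R G) [` xy]%fset [` yz]%fset.
  apply: connect1; apply/asboolP; split=> //=; left; apply/eqP.
  by rewrite eqn_leq outdeg_quad_le1 //; apply/outdeg_gt0P; exists z.
have ab : (a, b) \in G by rewrite mem_quad !inE eqxx.
have bc : (b, c) \in G by rewrite mem_quad !inE eqxx !orbT.
have cd : (c, d) \in G by rewrite mem_quad !inE eqxx !orbT.
have da : (d, a) \in G by rewrite mem_quad !inE eqxx !orbT.
have cases (t : G) :
    [\/ t = [` ab]%fset, t = [` bc]%fset, t = [` cd]%fset | t = [` da]%fset].
  have := valP t; rewrite /= mem_quad !inE => /or4P[] /eqP tE;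
    [apply: Or41|apply: Or42|apply: Or43|apply: Or44]; exact: val_inj.
(* Every dart is reached from the first one, and reaches it back. *)
have conn (s t : G) : connect (@follows R G) s t.
  have from t' : connect (@follows R G) [` ab]%fset t'.
    have abbc := next _ _ _ ab bc.
    have abcd' := connect_trans abbc (next _ _ _ bc cd).
    case: (cases t') => -> //.
    exact: connect_trans abcd' (next _ _ _ cd da).
  apply: connect_trans (from t).
  have daab := next _ _ _ da ab.
  have cdab := connect_trans (next _ _ _ cd da) daab.
  case: (cases s) => -> //.
  exact: connect_trans (next _ _ _ bc cd) cdab.
rewrite /Defs.rot; have -> : spliced_circles G = [set [set: G]]%SET.
  apply/setP => C; rewrite !inE; apply/imsetP/eqP => [[s _ ->]|->].
    by apply/setP => t; rewrite !inE conn.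
  by exists [` ab]%fset => //; apply/setP => t; rewrite !inE conn.
rewrite big_set1 /area2; congr (sgz _).
rewrite (eq_bigl xpredT) => [|s]; last by rewrite inE.
rewrite -(big_seq_fsetE _ G xpredT (fun s => cross (0, 0) s.1 s.2)).
exact: big_quad.
Qed.

Lemma quad_orientation (R : realType) (a b c d : pt R) :
  uniq [:: a; b; c; d] ->
  let U := (quad a b c d `|` flip (quad a b c d))%fset in
  embedded U -> quad a b c d \in balanced_orientations U.
Proof.
move=> abcd U eU; apply/balanced_orientationsP => //; split.
- by move=> s sq; rewrite in_fsetU sq.
- move=> s; rewrite in_fsetU mem_flip.
  suff nrev t : t \in quad a b c d -> rev_dart t \notin quad a b c d.
    case/orP => [sq|/[dup] /nrev]; first by rewrite sq (negbTE (nrev _ sq)).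
    by rewrite rev_dartK => /negbTE-> ->.
  rewrite !mem_quad; move: abcd; rewrite /= !inE !negb_or.
  case/and4P => /and3P[/negbTE ab /negbTE ac /negbTE ad].
  case/andP=> /negbTE bc /negbTE bd /negbTE cd _.
  move=> /or4P[] /eqP-> /=;
    rewrite !xpair_eqE ?(eq_sym b a) ?(eq_sym c a) ?(eq_sym d a);
    rewrite ?(eq_sym c b) ?(eq_sym d b) ?(eq_sym d c);
    by rewrite ?ab ?ac ?ad ?bc ?bd ?cd ?andbF.
move=> p; split; last exact: leq_trans (outdeg_quad_le1 p abcd) _.
by rewrite indeg_quad // outdeg_quad //; lia.
Qed.

(** One dart determines the orientation: each node entered has to be left, and
  it cannot be left along the dart opposite to the one just used. *)
Lemma quad_orientation_unique (R : realType) (a b c d : pt R)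
    (o : {fset dart R}) :
  uniq [:: a; b; c; d] ->
  let U := (quad a b c d `|` flip (quad a b c d))%fset in
  embedded U -> o \in balanced_orientations U -> (a, b) \in o ->
  o = quad a b c d.
Proof.
move=> abcd U eU /(balanced_orientationsP _ eU)[oU xo dego] abo.
have nrev s : s \in o -> rev_dart s \notin o.
  by move=> so; move: (xo _ (oU _ so)); rewrite so.
have step x y z : (x, y) \in o ->
    (forall t, t \in U -> t.1 = y -> t = (y, z) \/ t = (y, x)) -> (y, z) \in o.
  move=> xyo only.
  have /outdeg_gt0P[w yw] : (0 < outdeg o y)%N.
    by rewrite -(dego y).1; apply/indeg_gt0P; exists x.
  case: (only _ (oU _ yw) erefl) => yE; first by rewrite -yE.
  by have := nrev _ xyo; rewrite /rev_dart /= -yE yw.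
move: (abcd); rewrite /= !inE !negb_or.
case/and4P => /and3P[/eqP ab /eqP ac /eqP ad] /andP[/eqP bc /eqP bd] /eqP cd _.
have UE t : t \in U -> [\/ t = (a, b) \/ t = (b, a), t = (b, c) \/ t = (c, b),
    t = (c, d) \/ t = (d, c) | t = (d, a) \/ t = (a, d)].
  rewrite in_fsetU mem_flip !mem_quad !inE !rev_dart_eq.
  by case/orP => /or4P[] /eqP->;
    [apply: Or41|apply: Or42|apply: Or43|
    apply: Or44|apply: Or41|apply: Or42|apply: Or43|apply: Or44]; auto.
have bco : (b, c) \in o.
  apply: (step a) => // t /UE[] [] -> /=; intuition congruence.
have cdo : (c, d) \in o.
  apply: (step b) => // t /UE[] [] -> /=; intuition congruence.
have dao : (d, a) \in o.
  apply: (step c) => // t /UE[] [] -> /=; intuition congruence.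
have qo : {subset quad a b c d <= o}.
  by move=> t; rewrite mem_quad !inE => /or4P[] /eqP->.
apply/fsetP => t; apply/idP/idP => [to|]; last exact: qo.
have := oU _ to; rewrite in_fsetU mem_flip => /orP[//|/qo rto].
by rewrite (negbTE (nrev _ to)) in rto.
Qed.

Lemma uniq_swap (T : eqType) (a b c d : T) :
  uniq [:: a; b; c; d] -> uniq [:: b; a; d; c].
Proof.
rewrite (_ : uniq [:: b; a; d; c] = uniq [:: a; b; c; d]) //; apply: perm_uniq.
by rewrite (perm_catCA [:: b] [:: a]) /= !perm_cons (perm_catC [:: d] [:: c]).
Qed.

Lemma flip_quad_union (R : realType) (a b c d : pt R) :
  (quad b a d c `|` flip (quad b a d c) =
   quad a b c d `|` flip (quad a b c d))%fset.
Proof. by rewrite !flip_quad fsetUC. Qed.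

Lemma crossing_quad (R : realType) (a b c d : pt R) :
  uniq [:: a; b; c; d] ->
  embedded (quad a b c d `|` flip (quad a b c d))%fset ->
  crossing_graph (quad a b c d).
Proof.
move=> abcd eU; apply: crossing_of_degree1 => [|p]; last exact: outdeg_quad_le1.
exact: balanced_orientation_graph (quad_orientation abcd eU).
Qed.

Lemma evaluation_quad (R : realType) (br : {fset dart R} -> coef)
    (a b c d : pt R) :
  uniq [:: a; b; c; d] ->
  let U := (quad a b c d `|` flip (quad a b c d))%fset in
  embedded U ->
  evaluation br U = br (quad a b c d) + br (flip (quad a b c d)).
Proof.
move=> abcd U eU.
have badc := uniq_swap abcd; have UE := esym (flip_quad_union a b c d).
have qU : quad a b c d \in balanced_orientations U by exact: quad_orientation.
have q'U : quad b a d c \in balanced_orientations U.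
  by rewrite /U UE; apply: quad_orientation; rewrite -?UE.
rewrite /evaluation (perm_big [:: quad a b c d; quad b a d c]) /=.
  by rewrite !big_cons big_nil addr0 flip_quad.
apply: uniq_perm; [exact: fset_uniq| |].
  rewrite /= andbT inE; apply/negP => /eqP qq.
  have abq : (a, b) \in quad a b c d by rewrite mem_quad !inE eqxx.
  case/(balanced_orientationsP _ eU): qU => qU xq _.
  have := xq _ (qU _ abq); rewrite abq /=.
  by rewrite -mem_flip flip_quad -qq abq.
move=> o; rewrite mem_seq2; apply/idP/orP => [oU|[]/eqP-> //].
have [/(_ (a, b)) _ /(_ (a, b)) xo _] := balanced_orientationsP _ eU oU.
have abU : (a, b) \in U by rewrite in_fsetU mem_quad !inE eqxx.
case: (boolP ((a, b) \in o)) => [abo|nabo]; [left|right]; apply/eqP.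
  exact: quad_orientation_unique.
rewrite /U UE in eU oU; apply: quad_orientation_unique => //.
by move: (xo abU); rewrite (negbTE nabo).
Qed.

(** * The circle *)

Lemma pic_circleE (R : realType) :
  pic_circle R = quad (1, 0) (0, 1) (-1, 0) (0, -1).
Proof. by apply/fsetP => s; rewrite mem_quad in_fset. Qed.

Lemma uniq_circle (R : realType) :
  uniq [:: (1, 0); (0, 1); (-1, 0); (0, -1) : pt R].
Proof.
have ne (x y : R) : x < y -> (x == y) = false /\ (y == x) = false.
  by move=> xy; split; [exact: lt_eqF|exact: gt_eqF].
have [n01 n10] : ((0 : R) == 1) = false /\ ((1 : R) == 0) = false
  by apply: ne; lra.
have [nN0 n0N] : ((-1 : R) == 0) = false /\ ((0 : R) == -1) = false
  by apply: ne; lra.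
have [nN1 n1N] : ((-1 : R) == 1) = false /\ ((1 : R) == -1) = false
  by apply: ne; lra.
by rewrite /= !inE !xpair_eqE ?(n01, n10, nN0, n0N, nN1, n1N) /= ?andbF.
Qed.

Lemma embedded_circle (R : realType) : embedded (pic_circle R).
Proof.
move=> s t; rewrite pic_circleE !mem_quad !inE.
move=> /or4P[] /eqP-> /or4P[] /eqP->; rewrite ?eqxx // => _ _ p;
  move=> [[x /andP[x0 x1] ->]] [y /andP[y0 y1]] /= [e1 e2];
  (try by exfalso; lra); rewrite /ends /=;
  (* Opposite sides are disjoint and the case is contradictory; adjacent sides
     meet only at an end of the first one, where the parameter is 0 or 1. *)
  first [have {x0 x1 e1 e2} -> : x = 0 by lra
       | have {x0 x1 e1 e2} -> : x = 1 by lra];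
  by split; [first [by left; congr pair; lra|by right; congr pair; lra]
            |first [by left; congr pair; lra|by right; congr pair; lra]].
Qed.

Lemma q_neq0 : q != 0.
Proof. by rewrite tofrac_eq0 polyX_eq0. Qed.

Lemma qV_neq : q - q^-1 != 0.
Proof.
apply/negP; rewrite subr_eq0 => /eqP qV.
have : q * q = 1 by rewrite {2}qV divff // q_neq0.
rewrite /q -tofracM -tofrac1 => /eqP; rewrite tofrac_eq => /eqP XX.
have := congr1 (fun p : {poly int} => size p) XX.
by rewrite -expr2 size_polyXn size_poly1.
Qed.

(** With y = x^n, both sides times x - x^-1 equal
  (x / y + y / x) (y - y^-1) = y^2 / x - x / y^2 + (x - x^-1). *)
Lemma quantum_circle (F : fieldType) (x : F) (n : int) :
  x != 0 -> x - x^-1 != 0 ->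
  let qn m := (x ^ m - x ^ (- m)) / (x - x^-1) in
  x ^ (1 - n) * qn n + (x ^ (1 - n))^-1 * qn n = qn (2 * n - 1) + 1.
Proof.
move=> x0 xV qn.
have -> : x ^ (1 - n) = x / x ^ n by rewrite expfzDr // expr1z -invr_expz.
have x2n : x ^ (2 * n - 1) = x ^ n * x ^ n / x.
  have -> : 2 * n = n + n by rewrite mulrDl mul1r.
  by rewrite !expfzDr // expr1z.
have xn0 : x ^ n != 0 by exact: expfz_neq0.
rewrite /qn -!invr_expz x2n.
move: (x ^ n) xn0 xV => y y0 xV.
have x21 : x * x - 1 != 0.
  by apply: contra_neq xV => xx; apply: (mulfI x0); rewrite mulr0 mulrBr divff.
by field; rewrite x0 y0 x21.
Qed.

Lemma qint_circle (n : int) :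
  q ^ (1 - n) * qint n + (q ^ (1 - n))^-1 * qint n = qint (2 * n - 1) + 1.
Proof. exact: quantum_circle q_neq0 qV_neq. Qed.

Lemma crossing_graph0 (R : realType) : crossing_graph (fset0 : {fset dart R}).
Proof.
have fr p : fresh p (fset0 : {fset dart R}) by move=> t; rewrite in_fset0.
apply: crossing_of_degree1 => [|p]; last by rewrite (deg_fresh (fr p)).2.
split=> [s t|s|p]; [by rewrite in_fset0|by rewrite in_fset0|].
by have [-> ->] := deg_fresh (fr p).
Qed.

(** A relation that removes a closed picture is used with nothing outside the
  disk. *)
Lemma respects_closed (R : realType) (C : {fset dart R} -> Prop)
    (W : {fset dart R} -> coef) (x : coef) (G : {fset dart R}) :
  respects C W [:: (1, G)] [:: (x, fset0)] -> C G -> C fset0 ->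
  W G = x * W fset0.
Proof.
move=> rel CG C0; have := rel fset0; rewrite !big_seq1 /= !fset0U mul1r.
apply=> [s|t]; first by rewrite in_fset0.
by rewrite !inE => /orP[]/eqP-> /=; rewrite fset0U.
Qed.

Theorem proposition1 (R : realType) (n : nat) (hn : (2 <= n)%N)
    (W br : {fset dart R} -> coef)
    (hW : is_graph_polynomial n W) (hbr : is_bracket n W br)
    (circ : {fset dart R}) (hcirc : isotopic circ (unoriented_circle R)) :
  evaluation br circ = qint (2 * n%:Z - 1) + 1.
Proof.
rewrite (evaluation_isotopic (br_isotopy hbr) hcirc) /unoriented_circle.
have uC := uniq_circle R; have eC := embedded_flip_union (@embedded_circle R).
have [relC relF] := gp_circle hW; rewrite /= in relF.
have flip0 : flip (fset0 : {fset dart R}) = fset0.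
  by apply/fsetP => s; rewrite mem_flip !in_fset0.
rewrite flip0 in relF; rewrite pic_circleE in eC relC relF *.
rewrite evaluation_quad // flip_quad in relF *.
have cC := crossing_quad uC eC.
have uF := uniq_swap uC; have eF := eC; rewrite -flip_quad_union in eF.
have cF := crossing_quad uF eF.
rewrite (br_crossing hbr cC) (br_crossing hbr cF) !rot_quad //.
rewrite (respects_closed relC cC (@crossing_graph0 R)).
rewrite (respects_closed relF cF (@crossing_graph0 R)) (gp_empty hW) !mulr1.
rewrite /cross /= gtr0_sgz; last by lra.
rewrite ltr0_sgz; last by lra.
exact: qint_circle.
Qed.
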